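(* Let $q$ be a fixed nonzero complex number with $|q|<1$, let $r>0$, and let $d\ge 2$ be an integer. Let $a_1,\dots,a_d$ be complex-valued functions on the closed disc $\{z\in\mathbb{C}: |z|\le r\}$, and put $w_i=a_i(0)$ for $i=1,\dots,d$. Suppose that there exists a real number $M>0$ such that $$|a_i(z)-w_i|\le M|z|,\qquad 1\le i\le d,\ |z|\le r,$$ and that $$|w_d|+|w_{d-1}+w_d|+\cdots+|w_2+\cdots+w_d|<1,$$ $$w_1+w_2+\cdots+w_d=1.$$ Let $f$ be a continuous complex-valued function on the disc $|z|\le r$ satisfying the recurrence relation $$f(z)=a_1(z)f(zq)+a_2(z)f(zq^2)+\cdots+a_d(z)f(zq^d)\qquad\text{for all } |z|\le r.$$ Then $f$ is uniquely determined by $f(0)$ and the functions $a_1,\dots,a_d$; that is, if $g$ is any continuous complex-valued function on $|z|\le r$ satisfying the same recurrence relation $g(z)=\sum_{i=1}^d a_i(z)g(zq^i)$ for all $|z|\le r$, and $g(0)=f(0)$, then $g(z)=f(z)$ for all $|z|\le r$.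
   Context: The first sum condition is the sum over $i=2,\dots,d$ of the absolute values of the tail sums: $\sum_{i=2}^{d}\left|\sum_{j=i}^{d} w_j\right|<1$. *)

(* Defs.v *)
From Stdlib Require Import Reals.
From Coquelicot Require Import Coquelicot.

Open Scope R_scope.

(* Functions on the disc |z| <= r are represented by total functions C -> C
   of which only the values on the disc are ever constrained. *)
Definition closed_disc (r : R) (z : C) : Prop := Cmod z <= r.

(* The family a_1, ..., a_d is represented by a : nat -> C -> C; the entries
   with index outside {1, ..., d} are junk.  [sum_n_m u 1 d] is
   u 1 + ... + u d, with both bounds included. *)
Definition satisfies_recurrence
    (q : C) (r : R) (d : nat) (a : nat -> C -> C) (f : C -> C) : Prop :=
  forall z : C, closed_disc r z ->
    f z = sum_n_m (fun i : nat => (a i z * f (z * q ^ i))%C) 1 d.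

(* Main.v *)
(** Put [h = g - f], fix [z] and let [u n = h (z q^n)], a null sequence.  Abel
    summation turns the recurrence at [z q^n] into
    [u n - u (n+1) = sum_(i=2..d) W_i (u (n+i) - u (n+i-1)) + O(|q|^n max_i |u (n+i)|)],
    where [W_i = w_i + ... + w_d] and [W_1 = 1].  As [sum_(i>=2) |W_i| < 1], a
    bound [B] on [|u m|] for [m >= n] gives [|u (m+1) - u m| = O(|q|^m B)], and
    telescoping to the limit [0] gives [|u m| = O(|q|^m B)].  For [n] large this
    halves [B], so [u] vanishes eventually, hence everywhere by descending
    through the recurrence. *)
Require Import Defs.
From Stdlib Require Import Reals Lra Lia.
From Coquelicot Require Import Coquelicot.

(** * Finite complex sums: triangle inequality and Abel summation *)

Lemma Cmod_sum_n_m_le (v : nat -> C) (c : nat -> R) (n m : nat) :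
  (forall i, (n <= i <= m)%nat -> Cmod (v i) <= c i) ->
  Cmod (sum_n_m v n m) <= sum_n_m c n m.
Proof.
  induction m as [|m IH]; intros H.
  - destruct n as [|n].
    + rewrite !sum_n_n. apply H; lia.
    + rewrite !sum_n_m_zero by lia. change (Cmod (RtoC 0) <= 0).
      rewrite Cmod_0. lra.
  - destruct (Nat.le_gt_cases n (S m)) as [Hn|Hn].
    + rewrite !sum_n_Sm by lia.
      eapply Rle_trans; [apply Cmod_triangle|].
      apply Rplus_le_compat; [apply IH; intros; apply H; lia | apply H; lia].
    + rewrite !sum_n_m_zero by lia. change (Cmod (RtoC 0) <= 0).
      rewrite Cmod_0. lra.
Qed.

(** Trades the values of [v] for consecutive differences weighted by tail sums of [w], the
    quantities that the hypothesis controls. Peeling off index [n] works because, with [W] the tail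
    sum from [S n], [w n * v n + W * v (S n) = (w n + W) * v n + W * (v (S n) - v n)]. *)
Lemma abel_summation (w v : nat -> C) (n d : nat) : (n <= d)%nat ->
  sum_n_m (fun i => w i * v i)%C n d =
  (sum_n_m w n d * v n +
   sum_n_m (fun i => sum_n_m w i d * (v i - v (pred i)))%C (S n) d)%C.
Proof.
  intros Hn. remember (d - n)%nat as k eqn:Hk. revert n Hn Hk.
  induction k as [|k IH]; intros n Hn Hk.
  - assert (n = d) by lia; subst n.
    rewrite !sum_n_n, sum_n_m_zero by lia.
    change (@zero C_AbelianMonoid) with (RtoC 0).
    match goal with |- ?x = ?y => change (@eq C x y) end. ring.
  - rewrite (sum_Sn_m _ n d), (IH (S n)) by lia.
    rewrite (sum_Sn_m w n d),
      (sum_Sn_m (fun i => sum_n_m w i d * _)%C (S n) d) by lia.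
    change (@plus C_AbelianMonoid) with Cplus. simpl pred.
    match goal with |- ?x = ?y => change (@eq C x y) end. ring.
Qed.


(** * Limits and geometric estimates *)

Lemma is_lim_seq_cst_le (x l : R) (v : nat -> R) :
  is_lim_seq v l -> (forall n, x <= v n) -> x <= l.
Proof.
  intros Hv H.
  exact (is_lim_seq_le (fun _ => x) v x l H (is_lim_seq_const x) Hv).
Qed.

(** Telescoping to the limit 0 compares [Cmod (u m)] with a geometric tail of ratio [s]; the factor
    [1 - s] stays on the left to avoid a division. *)
Lemma null_seq_geometric_increments (u : nat -> C) (c s : R) (m : nat) :
  0 <= s < 1 -> 0 <= c -> is_lim_seq (fun n => Cmod (u n)) 0 ->
  (forall n, (m <= n)%nat -> Cmod (u (S n) - u n)%C <= c * s ^ n) ->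
  (1 - s) * Cmod (u m) <= c * s ^ m.
Proof.
  intros Hs Hc Hu Hinc.
  (* Here [s ^ m - s ^ (k + m)] is [1 - s] times the geometric sum over the exponents from [m] to
     [k + m - 1]. *)
  assert (T : forall k, (1 - s) * Cmod (u m) <=
                        (1 - s) * Cmod (u (k + m)%nat) + c * (s ^ m - s ^ (k + m))).
  { induction k as [|k IH]; [simpl; lra|].
    eapply Rle_trans; [apply IH|]. simpl Nat.add.
    assert (H := Hinc (k + m)%nat ltac:(lia)).
    assert (Ht : Cmod (u (k + m)%nat) <= Cmod (u (S (k + m))) + c * s ^ (k + m)).
    { replace (u (k + m)%nat)
        with (u (S (k + m)) + - (u (S (k + m)) - u (k + m)%nat))%C by ring.
      eapply Rle_trans; [apply Cmod_triangle|]. rewrite Cmod_opp. lra. }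
    apply (Rmult_le_compat_l (1 - s)) in Ht; [|lra]. simpl pow. lra. }
  replace (c * s ^ m) with ((1 - s) * 0 + c * s ^ m) by ring.
  apply (is_lim_seq_cst_le _ _ (fun k => (1 - s) * Cmod (u (k + m)%nat) + c * s ^ m)).
  - apply (is_lim_seq_plus' _ _ _ _).
    + apply (is_lim_seq_scal_l _ (1 - s) 0).
      now apply (is_lim_seq_incr_n (fun n => Cmod (u n)) m 0).
    + apply is_lim_seq_const.
  - intros k. specialize (T k).
    assert (0 <= s ^ (k + m)) by (apply pow_le; lra). nra.
Qed.

(** Start from the constant bound and iterate the step: each round multiplies the excess over the
    geometric term by [t], so only that term survives in the limit. *)
Lemma geometric_contraction_bound (D : nat -> R) (t s K X : R) :
  0 <= t < 1 -> 0 <= s < 1 -> 0 <= K ->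
  (forall n, D n <= X) ->
  (forall n Y, (forall m, (n <= m)%nat -> D m <= Y) -> D n <= t * Y + K * s ^ n) ->
  forall n, D n <= K / (1 - t) * s ^ n.
Proof.
  intros Ht Hs HK HX Hstep.
  assert (HX0 : D 0%nat <= Rabs X) by (eapply Rle_trans; [apply HX | apply Rle_abs]).
  assert (HK' : 0 <= K / (1 - t)).
  { apply Rmult_le_pos; [lra|]. left. apply Rinv_0_lt_compat. lra. }
  (* The constant [A] is the fixed point of [Y = t * Y + K], so a step reproduces [A * s ^ n]. *)
  assert (HE : K = K / (1 - t) - t * (K / (1 - t))) by (field; lra).
  set (A := K / (1 - t)) in *.
  assert (P : forall k n, D n <= A * s ^ n + t ^ k * Rabs X).
  { induction k as [|k IH]; intros n.
    - assert (0 <= A * s ^ n) by (apply Rmult_le_pos; [lra | apply pow_le; lra]).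
      assert (H1 := HX n). assert (H2 := Rle_abs X). simpl. lra.
    - eapply Rle_trans; [apply (Hstep n (A * s ^ n + t ^ k * Rabs X))|].
      (* As [s ^ m <= s ^ n] for [m >= n], the bound at [n] serves for all later indices. *)
      + intros m Hm. eapply Rle_trans; [apply IH|].
        apply Rplus_le_compat_r, Rmult_le_compat_l; [lra|].
        replace m with (n + (m - n))%nat by lia. rewrite pow_add.
        assert (0 <= s ^ n) by (apply pow_le; lra).
        assert (s ^ (m - n) <= 1 ^ (m - n)) by (apply pow_incr; lra).
        rewrite pow1 in *. nra.
      + simpl. rewrite HE at 1. right. ring. }
  intros n. replace (A * s ^ n) with (A * s ^ n + 0 * Rabs X) by ring.
  apply (is_lim_seq_cst_le _ _ (fun k => A * s ^ n + t ^ k * Rabs X)).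
  - apply (is_lim_seq_plus' _ _ _ _); [apply is_lim_seq_const|].
    apply (is_lim_seq_scal_r _ (Rabs X) 0).
    apply is_lim_seq_geom. rewrite Rabs_pos_eq; lra.
  - intros k. apply P.
Qed.

(** * The recurrence along a single sequence *)

(** Split [b i = w i + (b i - w i)]. Abel summation of the first part has leading term [u (S n)],
    because the [w i] sum to 1, and leaves increments; each of the [d] terms of the second part is
    at most [e * B]. *)
Lemma recurrence_increment_bound (d : nat) (w b u : nat -> C) (n : nat) (e B Y : R) :
  (1 <= d)%nat -> sum_n_m w 1 d = RtoC 1 ->
  (forall i, (1 <= i <= d)%nat -> Cmod (b i - w i)%C <= e) ->
  u n = sum_n_m (fun i => b i * u (n + i)%nat)%C 1 d ->
  (forall m, Cmod (u m) <= B) ->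
  (forall m, (n <= m)%nat -> Cmod (u (S m) - u m)%C <= Y) ->
  Cmod (u (S n) - u n)%C <=
    sum_n_m (fun i => Cmod (sum_n_m w i d)) 2 d * Y + INR d * B * e.
Proof.
  intros Hd Hw He Hn HB HY.
  set (v := fun i => u (n + i)%nat).
  assert (E : u n = (sum_n_m (fun i => w i * v i)%C 1 d
                     + sum_n_m (fun i => (b i - w i) * v i)%C 1 d)%C).
  { rewrite Hn. change Cplus with (@plus C_AbelianMonoid).
    rewrite <- sum_n_m_plus. apply sum_n_m_ext. intros i. unfold v.
    change (@plus C_AbelianMonoid) with Cplus.
    match goal with |- ?x = ?y => change (@eq C x y) end. ring. }
  rewrite abel_summation, Hw in E by lia.
  rewrite <- Cmod_opp.
  replace (- (u (S n) - u n))%C with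
    (sum_n_m (fun i => sum_n_m w i d * (v i - v (pred i)))%C 2 d
     + sum_n_m (fun i => (b i - w i) * v i)%C 1 d)%C.
  2: { rewrite E. replace (v 1%nat) with (u (S n)) by (unfold v; f_equal; lia). ring. }
  eapply Rle_trans; [apply Cmod_triangle|]. apply Rplus_le_compat.
  - rewrite <- (sum_n_m_mult_r (K := R_Ring) Y).
    apply Cmod_sum_n_m_le. intros i Hi. rewrite Cmod_mult.
    apply Rmult_le_compat_l; [apply Cmod_ge_0|].
    (* As [i >= 2], the difference is the increment of [u] at [n + pred i], an index beyond [n]. *)
    unfold v. replace (n + i)%nat with (S (n + pred i)) by lia.
    apply HY. lia.
  - replace (INR d * B * e) with (INR (S d - 1) * (e * B))
      by (replace (S d - 1)%nat with d by lia; ring).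
    rewrite <- (sum_n_m_const 1 d).
    apply Cmod_sum_n_m_le. intros i Hi. rewrite Cmod_mult.
    apply Rmult_le_compat; try apply Cmod_ge_0; [now apply He | apply HB].
Qed.

(** Contraction makes the increments geometric, and telescoping carries this over to [u]. The new
    bound is again linear in [B], with a factor proportional to [L]. *)
Lemma recurrence_null_bound (d : nat) (w : nat -> C) (b : nat -> nat -> C)
    (u : nat -> C) (s L B t : R) :
  0 <= s < 1 -> 0 <= L -> (1 <= d)%nat -> sum_n_m w 1 d = RtoC 1 ->
  t = sum_n_m (fun i => Cmod (sum_n_m w i d)) 2 d -> 0 <= t < 1 ->
  (forall n i, (1 <= i <= d)%nat -> Cmod (b n i - w i)%C <= L * s ^ n) ->
  (forall n, u n = sum_n_m (fun i => b n i * u (n + i)%nat)%C 1 d) ->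
  is_lim_seq (fun n => Cmod (u n)) 0 ->
  (forall n, Cmod (u n) <= B) ->
  forall n, Cmod (u n) <= INR d * L / (1 - t) / (1 - s) * B.
Proof.
  intros Hs HL Hd Hw Et Ht Hb Hrec Hu HB n.
  assert (HB0 : 0 <= B) by (eapply Rle_trans; [apply Cmod_ge_0 | apply (HB 0%nat)]).
  assert (HK : 0 <= INR d * B * L)
    by (repeat apply Rmult_le_pos; auto using pos_INR).
  assert (HK' : 0 <= INR d * B * L / (1 - t)).
  { apply Rmult_le_pos; [lra|]. left. apply Rinv_0_lt_compat. lra. }
  assert (D : forall m, Cmod (u (S m) - u m)%C <= INR d * B * L / (1 - t) * s ^ m).
  { apply (geometric_contraction_bound _ t s _ (B + B)); trivial.
    - intros m. eapply Rle_trans; [apply Cmod_triangle|].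
      rewrite Cmod_opp. now apply Rplus_le_compat.
    - intros m Y HY. rewrite Et.
      replace (INR d * B * L * s ^ m) with (INR d * B * (L * s ^ m)) by ring.
      apply (recurrence_increment_bound d w (b m)); auto. }
  assert (G := null_seq_geometric_increments u _ s n Hs HK' Hu (fun m _ => D m)).
  assert (s ^ n <= 1) by (rewrite <- (pow1 n); apply pow_incr; lra).
  replace (INR d * L / (1 - t) / (1 - s) * B)
    with (INR d * B * L / (1 - t) / (1 - s)) by (field; lra).
  apply Rle_div_r; [lra|]. nra.
Qed.

(** Shifting the sequence by [N] replaces [L] by [L * s ^ N], which brings the factor of the
    previous bound below 1/2; repeated halving then forces the shifted sequence to vanish. *)
Lemma recurrence_null_eventually_zero (d : nat) (w : nat -> C) (b : nat -> nat -> C)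
    (u : nat -> C) (s L : R) :
  0 <= s < 1 -> 0 <= L -> (1 <= d)%nat -> sum_n_m w 1 d = RtoC 1 ->
  sum_n_m (fun i => Cmod (sum_n_m w i d)) 2 d < 1 ->
  (forall n i, (1 <= i <= d)%nat -> Cmod (b n i - w i)%C <= L * s ^ n) ->
  (forall n, u n = sum_n_m (fun i => b n i * u (n + i)%nat)%C 1 d) ->
  is_lim_seq (fun n => Cmod (u n)) 0 ->
  exists N, forall n, (N <= n)%nat -> u n = RtoC 0.
Proof.
  intros Hs HL Hd Hw Ht Hb Hrec Hu.
  remember (sum_n_m (fun i => Cmod (sum_n_m w i d)) 2 d) as t eqn:Et.
  assert (Ht0 : 0 <= t).
  { rewrite Et. eapply Rle_trans; [apply Cmod_ge_0|].
    apply (Cmod_sum_n_m_le (fun i => sum_n_m w i d)). intros. lra. }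
  set (c := INR d * L / (1 - t) / (1 - s)).
  assert (Hsmall : is_lim_seq (fun n => c * s ^ n) 0).
  { replace (Finite 0) with (Rbar_mult c 0) by (simpl; f_equal; ring).
    apply is_lim_seq_scal_l, is_lim_seq_geom. rewrite Rabs_pos_eq; lra. }
  apply is_lim_seq_spec in Hsmall. destruct (Hsmall (mkposreal (1/2) ltac:(lra))) as [N1 H1].
  assert (Hu' := Hu).
  apply is_lim_seq_spec in Hu'. destruct (Hu' (mkposreal 1 Rlt_0_1)) as [N2 H2].
  simpl in H1, H2.
  (* [N1] makes the factor [c * s ^ N] less than 1/2; [N2] gives the initial bound 1 for the
     halving. *)
  set (N := max N1 N2). exists N.
  set (u' := fun n => u (n + N)%nat).
  assert (Hnull : is_lim_seq (fun n => Cmod (u' n)) 0)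
    by exact (proj1 (is_lim_seq_incr_n _ N 0) Hu).
  assert (P : forall k n, Cmod (u' n) <= (1/2) ^ k).
  { induction k as [|k IH]; intros n.
    - specialize (H2 (n + N)%nat ltac:(lia)).
      rewrite Rminus_0_r, Rabs_pos_eq in H2 by apply Cmod_ge_0.
      simpl. unfold u'. lra.
    - eapply Rle_trans.
      + apply (recurrence_null_bound d w (fun n => b (n + N)%nat) u' s (L * s ^ N)
                 ((1/2) ^ k) t); trivial; [| lra | |].
        * apply Rmult_le_pos; [lra | apply pow_le; lra].
        * intros m i Hi. rewrite Rmult_assoc, <- pow_add, Nat.add_comm. now apply Hb.
        * intros m. unfold u'. rewrite Hrec. apply sum_n_m_ext. intros i.
          do 2 f_equal. lia.
      + simpl pow. apply Rmult_le_compat_r; [apply pow_le; lra|].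
        specialize (H1 N ltac:(lia)). apply Rabs_def2 in H1.
        replace (INR d * (L * s ^ N) / (1 - t) / (1 - s)) with (c * s ^ N)
          by (unfold c; field; lra).
        lra. }
  intros n Hn. apply Cmod_eq_0, Rle_antisym; [|apply Cmod_ge_0].
  apply (is_lim_seq_cst_le _ _ (fun k => (1/2) ^ k)).
  - apply is_lim_seq_geom. rewrite Rabs_pos_eq; lra.
  - intros k. replace n with (n - N + N)%nat by lia. apply (P k (n - N)%nat).
Qed.

(** The recurrence expresses [u m] through strictly later terms only, so the threshold [N] can be
    lowered one step at a time. *)
Lemma recurrence_zero_of_eventually_zero (d N : nat) (b : nat -> nat -> C)
    (u : nat -> C) :
  (forall n, u n = sum_n_m (fun i => b n i * u (n + i)%nat)%C 1 d) ->
  (forall n, (N <= n)%nat -> u n = RtoC 0) -> forall n, u n = RtoC 0.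
Proof.
  intros Hrec. induction N as [|N IH]; intros H n; [apply H; lia|].
  apply IH. intros m Hm. rewrite Hrec. apply Cmod_eq_0, Rle_antisym; [|apply Cmod_ge_0].
  eapply Rle_trans; [apply (Cmod_sum_n_m_le _ (fun _ => 0))|].
  - intros i Hi. rewrite H by lia. rewrite Cmult_0_r, Cmod_0. lra.
  - rewrite sum_n_m_const. lra.
Qed.

(** * From functions on the disc to sequences *)

Lemma continuous_on_disc_geometric (r : R) (q z : C) (h : C -> C) :
  0 < r -> Cmod q < 1 -> closed_disc r z -> continuous_on (closed_disc r) h ->
  is_lim_seq (fun n => Cmod (h (z * q ^ n)%C - h (RtoC 0))%C) 0.
Proof.
  intros Hr Hq Hz Hh. unfold closed_disc in Hz.
  assert (H0 : closed_disc r (RtoC 0)) by (unfold closed_disc; rewrite Cmod_0; lra).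
  assert (Hq0 := Cmod_ge_0 q). assert (Hz0 := Cmod_ge_0 z).
  apply is_lim_seq_spec. intros eps.
  (* Balls in [C] are taken coordinatewise, so passing from a ball to [Cmod] costs a factor
     [sqrt 2]. *)
  assert (He : 0 < eps / sqrt 2)
    by (apply Rdiv_lt_0_compat; [apply eps | apply Rlt_sqrt2_0]).
  destruct (Hh _ H0 (ball (h (RtoC 0)) (eps / sqrt 2))
              (locally_ball _ (mkposreal _ He))) as [del Hdel].
  assert (Hlim : is_lim_seq (fun n => r * Cmod q ^ n) 0).
  { replace (Finite 0) with (Rbar_mult r 0) by (simpl; f_equal; ring).
    apply is_lim_seq_scal_l, is_lim_seq_geom. rewrite Rabs_pos_eq; lra. }
  apply is_lim_seq_spec in Hlim. destruct (Hlim del) as [N HN].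
  exists N. intros n Hn. rewrite Rminus_0_r, Rabs_pos_eq by apply Cmod_ge_0.
  assert (Hp : 0 <= Cmod q ^ n <= 1)
    by (split; [apply pow_le | rewrite <- (pow1 n); apply pow_incr]; lra).
  assert (Hm : Cmod (z * q ^ n)%C = Cmod z * Cmod q ^ n)
    by now rewrite Cmod_mult, Cmod_pow.
  replace (pos eps) with (sqrt 2 * (eps / sqrt 2)) by (field; apply Rgt_not_eq, Rlt_sqrt2_0).
  apply (C_NormedModule_mixin_compat2 (h (RtoC 0)) _ (mkposreal _ He)).
  apply Hdel.
  - apply C_NormedModule_mixin_compat1.
    change (Cmod (z * q ^ n - RtoC 0)%C < del).
    replace (z * q ^ n - RtoC 0)%C with (z * q ^ n)%C by ring.
    specialize (HN n Hn). apply Rabs_def2 in HN. rewrite Hm. nra.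
  - unfold closed_disc. rewrite Hm. nra.
Qed.

Theorem theorem1
  (q : C) (q_neq0 : q <> RtoC 0) (q_lt1 : Cmod q < 1)
  (r : R) (r_gt0 : 0 < r)
  (d : nat) (d_ge2 : (2 <= d)%nat)
  (a : nat -> C -> C) (w : nat -> C)
  (w_def : forall i : nat, (1 <= i <= d)%nat -> w i = a i (RtoC 0))
  (a_lip : exists M : R, 0 < M /\
     forall (i : nat) (z : C), (1 <= i <= d)%nat -> closed_disc r z ->
       Cmod (a i z - w i)%C <= M * Cmod z)
  (tail_sums : sum_n_m (fun i : nat => Cmod (sum_n_m w i d)) 2 d < 1)
  (w_sum : sum_n_m w 1 d = RtoC 1)
  (f : C -> C)
  (f_cont : continuous_on (closed_disc r) f)
  (f_rec : satisfies_recurrence q r d a f) :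
  forall g : C -> C,
    continuous_on (closed_disc r) g ->
    satisfies_recurrence q r d a g ->
    g (RtoC 0) = f (RtoC 0) ->
    forall z : C, closed_disc r z -> g z = f z.
Proof.
  intros g g_cont g_rec g0 z Hz.
  destruct a_lip as [M [M_gt0 a_lip]].
  assert (Hq0 := Cmod_ge_0 q). assert (Hz0 := Cmod_ge_0 z).
  assert (Hzn : forall n, closed_disc r (z * q ^ n)%C).
  { intros n. unfold closed_disc in *. rewrite Cmod_mult, Cmod_pow.
    assert (0 <= Cmod q ^ n <= 1)
      by (split; [apply pow_le | rewrite <- (pow1 n); apply pow_incr]; lra).
    nra. }
  set (u := fun n : nat => (g (z * q ^ n) - f (z * q ^ n))%C).
  set (b := fun n i : nat => a i (z * q ^ n)%C).
  assert (Hrec : forall n, u n = sum_n_m (fun i => b n i * u (n + i)%nat)%C 1 d).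
  { intros n. unfold u at 1. rewrite (f_rec _ (Hzn n)), (g_rec _ (Hzn n)).
    set (F := sum_n_m (fun i => a i (z * q ^ n) * f _)%C 1 d).
    replace (sum_n_m (fun i => a i (z * q ^ n) * g (z * q ^ n * q ^ i))%C 1 d)
      with (plus (sum_n_m (fun i => b n i * u (n + i)%nat)%C 1 d) F).
    - change (@plus C_AbelianMonoid) with Cplus. ring.
    - unfold F. rewrite <- sum_n_m_plus. apply sum_n_m_ext. intros i.
      unfold u, b. rewrite Cpow_add_r, Cmult_assoc.
      change (@plus C_AbelianMonoid) with Cplus.
      match goal with |- ?x = ?y => change (@eq C x y) end. ring. }
  (* Since [g] and [f] agree at 0, [u n] is the difference of their deviations from the value
     there. *)
  assert (Hnull : is_lim_seq (fun n => Cmod (u n)) 0).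
  { apply (is_lim_seq_le_le (fun _ => 0) _
      (fun n => Cmod (g (z * q ^ n)%C - g (RtoC 0))%C
                + Cmod (f (z * q ^ n)%C - f (RtoC 0))%C)).
    - intros n. split; [apply Cmod_ge_0|].
      rewrite <- (Cmod_opp (f (z * q ^ n)%C - f (RtoC 0))%C).
      eapply Rle_trans; [|apply Cmod_triangle].
      right. f_equal. unfold u. rewrite g0. ring.
    - apply is_lim_seq_const.
    - assert (E : Finite 0 = Finite (0 + 0)) by (f_equal; ring). rewrite E.
      apply is_lim_seq_plus'; now apply (continuous_on_disc_geometric r). }
  (* The Lipschitz bound at [z * q ^ n] is [M * Cmod z * Cmod q ^ n], whence the choice of [s] and
     [L]. *)
  destruct (recurrence_null_eventually_zero d w b u (Cmod q) (M * Cmod z))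
    as [N HN]; trivial; try lra; try lia.
  - apply Rmult_le_pos; lra.
  - intros n i Hi. unfold b.
    rewrite Rmult_assoc, <- Cmod_pow, <- Cmod_mult. now apply a_lip.
  - assert (Z := recurrence_zero_of_eventually_zero d N b u Hrec HN 0%nat).
    unfold u in Z. simpl in Z. rewrite Cmult_1_r in Z.
    replace (g z) with ((g z - f z) + f z)%C by ring. rewrite Z. ring.
Qed.
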